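(* Let $d,m,k\ge 1$ be integers, $L,\beta>0$, $T=km$, and let $\eta_1,\dots,\eta_T$ be step sizes with $0<\eta_t\le\frac{2}{\beta}$ for $t=1,\dots,T$. Let $Z$ be a set of examples and $\ell:\mathbb{R}^d\times Z\to\mathbb{R}$ a loss function such that for every $z\in Z$ the function $\ell(\cdot,z)$ is convex, $L$-Lipschitz and $\beta$-smooth on $\mathbb{R}^d$. Let $S,S^i\in Z^m$ be any two neighboring datasets, differing only at the $i$-th data point. Let $r$ be a permutation of $[m]$ and let $i^*=r(i)$. Let $w_0,\dots,w_T$ and $w_0',\dots,w_T'$ be the iterates of $k$-pass PSGD run on $S$ and on $S^i$, respectively, with the same permutation $r$, the same step sizes $\eta_t$ and the same starting point $w_0=w_0'$, and let $\delta_T=\|w_T-w_T'\|$. Then $$\delta_T\le 2L\sum_{j=0}^{k-1}\eta_{i^*+jm}.$$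
   Context: $\|\cdot\|$ is the Euclidean norm and $[m]=\{1,\dots,m\}$. A differentiable $f:\mathbb{R}^d\to\mathbb{R}$ is convex if $f(u)\ge f(v)+\langle\nabla f(v),u-v\rangle$ for all $u,v$; $L$-Lipschitz if $|f(u)-f(v)|\le L\|u-v\|$; $\beta$-smooth if $\|\nabla f(u)-\nabla f(v)\|\le\beta\|u-v\|$. $k$-pass PSGD (permutation-based SGD) on $S=(z_1,\dots,z_m)\in Z^m$ with permutation $r$ of $[m]$, step sizes $\eta_1,\dots,\eta_{km}$ and starting point $w_0$: for $t=1,\dots,km$ write $t=s+jm$ with $1\le s\le m$, $0\le j\le k-1$, and set $w_t=w_{t-1}-\eta_t\nabla\ell(w_{t-1},z_{r^{-1}(s)})$ (gradient in the first argument). Thus the data point with index $i$ is processed exactly at steps $r(i)+jm$, $j=0,\dots,k-1$. *)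

(* Defs.v *)
From mathcomp Require Import all_boot all_order all_algebra all_fingroup.
From mathcomp Require Import all_classical all_reals all_analysis.

Set Implicit Arguments.
Unset Strict Implicit.
Unset Printing Implicit Defensive.

Import Order.TTheory GRing.Theory Num.Theory.
Import numFieldNormedType.Exports.

Local Open Scope ring_scope.

(* The library norm `|v| on 'rV[R]_d is the sup norm, so the Euclidean inner
   product and norm are defined here; differentiability does not depend on the
   choice of norm. *)
Definition dotr (R : realType) (d : nat) (u v : 'rV[R]_d) : R :=
  \sum_(j < d) u 0 j * v 0 j.

Definition enorm (R : realType) (d : nat) (v : 'rV[R]_d) : R :=
  Num.sqrt (dotr v v).

(* Meaningful for differentiable functions only: [grad] is total. *)
Definition grad (R : realType) (d : nat) (f : 'rV[R]_d -> R) (v : 'rV[R]_d) :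
  'rV[R]_d := \row_(j < d) 'D_(delta_mx 0 j) f v.

Definition differentiable_everywhere (R : realType) (d : nat)
    (f : 'rV[R]_d -> R) : Prop :=
  forall v, differentiable f v.

Definition first_order_convex (R : realType) (d : nat) (f : 'rV[R]_d -> R) : Prop :=
  forall u v, f u >= f v + dotr (grad f v) (u - v).

Definition elipschitz (R : realType) (d : nat) (L : R) (f : 'rV[R]_d -> R) :
  Prop := forall u v, `|f u - f v| <= L * enorm (u - v).

Definition smooth (R : realType) (d : nat) (beta : R) (f : 'rV[R]_d -> R) :
  Prop := forall u v, enorm (grad f u - grad f v) <= beta * enorm (u - v).

Definition neighboring (Z : Type) (m : nat) (i : 'I_m) (S S' : m.-tuple Z) :
  Prop := forall l : 'I_m, l != i -> tnth S l = tnth S' l.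

(* [w 0], ..., [w (k * m)] are the iterates of k-pass PSGD.  Positions in [m]
   are elements of 'I_m, hence shifted down by one, while steps are numbered
   from 1 as usual: [s : 'I_m] stands for position s + 1, and in pass j it is
   visited at step t = s + 1 + j m. Values of [eta] outside 1..km and of [w]
   beyond km are irrelevant. *)
Definition psgd_iterates (R : realType) (d m k : nat) (Z : Type)
    (ell : 'rV[R]_d -> Z -> R) (S : m.-tuple Z) (r : {perm 'I_m})
    (eta : nat -> R) (w0 : 'rV[R]_d) (w : nat -> 'rV[R]_d) : Prop :=
  w 0%N = w0 /\
  forall (j : nat) (s : 'I_m), (j < k)%N ->
    w (s.+1 + j * m)%N =
      w (s + j * m)%N
      - eta (s.+1 + j * m)%N
        *: grad (ell^~ (tnth S ((r^-1)%g s))) (w (s + j * m)%N).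

(* Main.v *)
(* Comparing f y with f (y - (grad f y - grad f x) / beta) through the descent
   inequality gives the co-coercivity of the gradient, so for step sizes at most
   2 / beta a gradient step on a common example does not increase the distance
   between the two runs. Each pass has only one step at which the examples
   differ, and it adds at most 2 * L * eta. *)
Require Import Defs.
From mathcomp Require Import all_boot all_order all_algebra all_fingroup.
From mathcomp Require Import all_classical all_reals all_analysis.
From mathcomp Require Import ring lra zify.
Import Order.TTheory GRing.Theory Num.Theory.
Import numFieldNormedType.Exports.
Local Open Scope ring_scope.

Lemma dotrC {R : realType} {d : nat} (u v : 'rV[R]_d) : dotr u v = dotr v u.
Proof. by apply: eq_bigr => j _; rewrite mulrC. Qed.

Lemma dotrDl {R : realType} {d : nat} (u v x : 'rV[R]_d) :
  dotr (u + v) x = dotr u x + dotr v x.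
Proof.
by rewrite /dotr -big_split /=; apply: eq_bigr => j _; rewrite mxE mulrDl.
Qed.

Lemma dotrZl {R : realType} {d : nat} (a : R) (u x : 'rV[R]_d) :
  dotr (a *: u) x = a * dotr u x.
Proof.
by rewrite /dotr mulr_sumr; apply: eq_bigr => j _; rewrite mxE mulrA.
Qed.

Lemma dotrNl {R : realType} {d : nat} (u x : 'rV[R]_d) :
  dotr (- u) x = - dotr u x.
Proof. by rewrite -scaleN1r dotrZl mulN1r. Qed.

Lemma dotrDr {R : realType} {d : nat} (u v x : 'rV[R]_d) :
  dotr x (u + v) = dotr x u + dotr x v.
Proof. by rewrite dotrC dotrDl !(dotrC x). Qed.

Lemma dotrZr {R : realType} {d : nat} (a : R) (u x : 'rV[R]_d) :
  dotr x (a *: u) = a * dotr x u.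
Proof. by rewrite dotrC dotrZl dotrC. Qed.

Lemma dotrNr {R : realType} {d : nat} (u x : 'rV[R]_d) :
  dotr x (- u) = - dotr x u.
Proof. by rewrite dotrC dotrNl dotrC. Qed.

Definition dotrE := (@dotrDl, @dotrDr, @dotrNl, @dotrNr, @dotrZl, @dotrZr).

Lemma dotr_ge0 {R : realType} {d : nat} (u : 'rV[R]_d) : 0 <= dotr u u.
Proof. by apply: sumr_ge0 => j _; rewrite -expr2 sqr_ge0. Qed.

Lemma enorm_ge0 {R : realType} {d : nat} (u : 'rV[R]_d) : 0 <= enorm u.
Proof. exact: sqrtr_ge0. Qed.

Lemma sqr_enorm {R : realType} {d : nat} (u : 'rV[R]_d) :
  enorm u ^+ 2 = dotr u u.
Proof. by rewrite sqr_sqrtr ?dotr_ge0. Qed.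

Lemma enormZ {R : realType} {d : nat} (a : R) (u : 'rV[R]_d) :
  enorm (a *: u) = `|a| * enorm u.
Proof.
by rewrite /enorm !dotrE mulrA -expr2 sqrtrM ?sqr_ge0// sqrtr_sqr.
Qed.

Lemma enormN {R : realType} {d : nat} (u : 'rV[R]_d) : enorm (- u) = enorm u.
Proof. by rewrite -scaleN1r enormZ normrN1 mul1r. Qed.

Lemma enorm_eq0 {R : realType} {d : nat} (u : 'rV[R]_d) :
  enorm u = 0 -> u = 0.
Proof.
move=> u0; have /eqP : dotr u u = 0 by rewrite -sqr_enorm u0 expr0n.
rewrite psumr_eq0 => [/allP uu0|j _]; last by rewrite -expr2 sqr_ge0.
apply/rowP => j; rewrite mxE.
by have /eqP/eqP := uu0 j (mem_index_enum _); rewrite -expr2 sqrf_eq0 => /eqP.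
Qed.

(** Cauchy-Schwarz, from expanding the square of [enorm v *: u - enorm u *: v] and dividing by
    [enorm u * enorm v]; hence the separate treatment of zero vectors. *)
Lemma dotr_le {R : realType} {d : nat} (u v : 'rV[R]_d) :
  dotr u v <= enorm u * enorm v.
Proof.
have [/enorm_eq0->|u0] := eqVneq (enorm u) 0.
  by rewrite -(scale0r 0) dotrZl mul0r mulr_ge0 ?enorm_ge0.
have [/enorm_eq0->|v0] := eqVneq (enorm v) 0.
  by rewrite -(scale0r 0) dotrZr mul0r mulr_ge0 ?enorm_ge0.
have uv_gt0 : 0 < enorm u * enorm v by rewrite mulr_gt0// lt0r ?u0 ?v0 enorm_ge0.
rewrite -(ler_pM2l uv_gt0).
have := dotr_ge0 (enorm v *: u - enorm u *: v).
by rewrite !dotrE -!sqr_enorm (dotrC v u); lra.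
Qed.

Lemma ler_enormD {R : realType} {d : nat} (u v : 'rV[R]_d) :
  enorm (u + v) <= enorm u + enorm v.
Proof.
rewrite -ler_sqr ?nnegrE ?addr_ge0 ?enorm_ge0// sqr_enorm !dotrE -!sqr_enorm.
by rewrite (dotrC v u); have := dotr_le u v; lra.
Qed.

(** Along the displacement [g = grad f v], convexity makes [f] grow by at least the square of
    [enorm g], while the Lipschitz bound allows at most [L * enorm g]. *)
Lemma enorm_grad_le {R : realType} {d : nat} {L : R} {f : 'rV[R]_d -> R}
    (v : 'rV[R]_d) :
  first_order_convex f -> elipschitz L f -> 0 <= L -> enorm (grad f v) <= L.
Proof.
move=> cvx lip L0; set g := grad f v.
have := le_trans (ler_norm _) (lip (v + g) v); have := cvx (v + g) v.
rewrite [v + g]addrC addrK -/g -sqr_enorm => c l.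
have [->//|g0] := eqVneq (enorm g) 0.
have gp : 0 < enorm g by rewrite lt0r g0 enorm_ge0.
by rewrite -(ler_pM2r gp); lra.
Qed.

(* Convexity gives the constant beta in place of beta / 2; applying the
   inequality on both halves of the segment turns a constant C into
   C / 2 + beta / 4, which converges to beta / 2. *)
Lemma smooth_descent_approx {R : realType} {d : nat} {beta : R}
    {f : 'rV[R]_d -> R} (n : nat) (v h : 'rV[R]_d) :
  first_order_convex f -> smooth beta f ->
  f (v + h) <= f v + dotr (grad f v) h
               + beta / 2 * (1 + 2^-1 ^+ n) * enorm h ^+ 2.
Proof.
move=> cvx sm.
have grad_le (x y : 'rV[R]_d) :
    dotr (grad f (x + y)) y <= dotr (grad f x) y + beta * enorm y ^+ 2.
  have /(ler_wpM2r (enorm_ge0 y)) := sm (x + y) x.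
  rewrite [in X in _ <= X](addrC x) addrK.
  have := dotr_le (grad f (x + y) - grad f x) y; rewrite !dotrE; lra.
elim: n v h => [|n IH] v h.
  have := cvx v (v + h); have -> : v - (v + h) = - h by rewrite opprD addNKr.
  by rewrite dotrNr expr0; have := grad_le v h; lra.
pose y := 2^-1 *: h.
have hE : h = y + y by rewrite -scalerDl -[LHS]scale1r; congr (_ *: _); field.
have nE : enorm h = 2 * enorm y.
  by rewrite enormZ ger0_norm; [field|lra].
(* Two steps of length [y]; moving the gradient of the second one back from [v + y] to [v] costs
   [beta * enorm y ^+ 2], which is the term beta / 4 relative to [h]. *)
have := IH v y; have := IH (v + y) y; have := grad_le v y.
rewrite -addrA -hE nE (exprS 2^-1).
rewrite [in dotr _ h]hE dotrDr; lra.
Qed.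

(** Letting [n] tend to infinity in [smooth_descent_approx] takes the place of integrating the
    gradient along the segment. *)
Lemma smooth_descent {R : realType} {d : nat} {beta : R} {f : 'rV[R]_d -> R}
    (v h : 'rV[R]_d) :
  first_order_convex f -> smooth beta f ->
  f (v + h) <= f v + dotr (grad f v) h + beta / 2 * enorm h ^+ 2.
Proof.
move=> cvx sm; set b := beta / 2 * enorm h ^+ 2; set a := f v + _.
have half_cvg : ((fun n : nat => (2^-1 : R) ^+ n) @ \oo --> (0 : R))%classic.
  by apply: cvg_expr; rewrite ger0_norm; lra.
have cvg_bound : ((fun n : nat => a + b + b * 2^-1 ^+ n) @ \oo --> a + b)%classic.
  rewrite -[X in (_ --> X)%classic]addr0 -(mulr0 b).
  by apply: cvgD; [exact: cvg_cst|apply: cvgM => //; exact: cvg_cst].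
rewrite -(cvg_lim _ cvg_bound)//; apply: limr_ge.
  by apply/cvg_ex; exists (a + b).
apply: nearW => n; have := smooth_descent_approx n v h cvx sm.
by rewrite -/a /b; lra.
Qed.

Lemma smooth_convex_ge {R : realType} {d : nat} {beta : R}
    {f : 'rV[R]_d -> R} (x y : 'rV[R]_d) :
  first_order_convex f -> smooth beta f -> 0 < beta ->
  f x + dotr (grad f x) (y - x)
    + (2 * beta)^-1 * enorm (grad f y - grad f x) ^+ 2 <= f y.
Proof.
move=> cvx sm b0; move eE: (grad f y - grad f x) => e.
(* The displacement [- (beta^-1 *: e)] minimises the quadratic upper bound at [y] of [f] minus its
   tangent at [x]; convexity at [x] bounds the same value of [f] from below. *)
have := smooth_descent y (- (beta^-1 *: e)) cvx sm.
have := cvx (y - beta^-1 *: e) x.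
have : dotr e e = dotr (grad f y) e - dotr (grad f x) e.
  by rewrite -dotrNl -dotrDl eE.
rewrite !sqr_enorm !dotrE => ->.
set p := dotr _ e; set q := dotr _ e => le1 le2.
have := le_trans le1 le2; rewrite -subr_ge0 -[in X in _ -> X]subr_ge0.
by congr (0 <= _); field; rewrite gt_eqF.
Qed.

(** In the sum of [smooth_convex_ge] for [x, y] and for [y, x] the values of [f] cancel. *)
Lemma grad_cocoercive {R : realType} {d : nat} {beta : R}
    {f : 'rV[R]_d -> R} (x y : 'rV[R]_d) :
  first_order_convex f -> smooth beta f -> 0 < beta ->
  beta^-1 * enorm (grad f x - grad f y) ^+ 2
    <= dotr (grad f x - grad f y) (x - y).
Proof.
move=> cvx sm b0.
have := smooth_convex_ge x y cvx sm b0; have := smooth_convex_ge y x cvx sm b0.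
by rewrite -(enormN (grad f y - _)) opprB invfM !dotrE; lra.
Qed.

Lemma grad_step_nonexpansive {R : realType} {d : nat} {beta eta : R}
    {f : 'rV[R]_d -> R} (x y : 'rV[R]_d) :
  first_order_convex f -> smooth beta f -> 0 < beta -> 0 < eta <= 2 / beta ->
  enorm ((x - eta *: grad f x) - (y - eta *: grad f y)) <= enorm (x - y).
Proof.
move=> cvx sm b0 /andP[eta0 eta_le].
have -> : (x - eta *: grad f x) - (y - eta *: grad f y)
    = (x - y) - eta *: (grad f x - grad f y).
  by rewrite scalerBr !opprD !opprK addrACA.
rewrite -ler_sqr ?nnegrE ?enorm_ge0//.
have := grad_cocoercive x y cvx sm b0.
set e := grad f x - grad f y; set z := x - y => coco.
rewrite !sqr_enorm (dotrDl z) !(dotrDr z) !dotrNl !dotrNr !dotrZl !dotrZr.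
rewrite (dotrC z e) -(sqr_enorm e).
have e0 : 0 <= enorm e ^+ 2 by rewrite sqr_ge0.
(* By co-coercivity the squared distance drops by at least [eta * (2 / beta - eta) * enorm e ^+ 2],
   which is nonnegative. *)
have := ler_wpM2r e0 eta_le; nra.
Qed.

Lemma grad_step_lipschitz {R : realType} {d : nat} {L eta : R}
    {f g : 'rV[R]_d -> R} (x y : 'rV[R]_d) :
  first_order_convex f -> elipschitz L f ->
  first_order_convex g -> elipschitz L g -> 0 <= L -> 0 <= eta ->
  enorm ((x - eta *: grad f x) - (y - eta *: grad g y))
    <= enorm (x - y) + 2 * L * eta.
Proof.
move=> cvxf lipf cvxg lipg L0 eta0.
have -> : (x - eta *: grad f x) - (y - eta *: grad g y)
    = (x - y) + eta *: (grad g y - grad f x).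
  by rewrite scalerBr opprD opprK addrACA (addrC (- (eta *: _))).
apply: le_trans (ler_enormD _ _) _; rewrite lerD2l enormZ ger0_norm//.
have := ler_enormD (grad g y) (- grad f x); rewrite enormN.
have := enorm_grad_le x cvxf lipf L0; have := enorm_grad_le y cvxg lipg L0.
by nra.
Qed.

Theorem lemma6 (R : realType) (d m k : nat)
  (d_ge1 : (1 <= d)%N) (m_ge1 : (1 <= m)%N) (k_ge1 : (1 <= k)%N)
  (L beta : R) (L_gt0 : 0 < L) (beta_gt0 : 0 < beta)
  (eta : nat -> R)
  (eta_bnd : forall t : nat, (1 <= t <= k * m)%N -> 0 < eta t <= 2 / beta)
  (Z : Type) (ell : 'rV[R]_d -> Z -> R)
  (ell_diff : forall z : Z, differentiable_everywhere (ell^~ z))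
  (ell_convex : forall z : Z, first_order_convex (ell^~ z))
  (ell_lip : forall z : Z, elipschitz L (ell^~ z))
  (ell_smooth : forall z : Z, smooth beta (ell^~ z))
  (i : 'I_m) (S Si : m.-tuple Z) (S_Si : neighboring i S Si)
  (r : {perm 'I_m}) (w0 : 'rV[R]_d) (w w' : nat -> 'rV[R]_d)
  (w_psgd : psgd_iterates k ell S r eta w0 w)
  (w'_psgd : psgd_iterates k ell Si r eta w0 w') :
  enorm (w (k * m)%N - w' (k * m)%N)
    <= 2 * L * \sum_(0 <= j < k) eta ((r i).+1 + j * m)%N.
Proof.
have [w_0 w_step] := w_psgd; have [w'_0 w'_step] := w'_psgd.
pose delta t := enorm (w t - w' t).
have step j (s : 'I_m) : (j < k)%N ->
    delta (s.+1 + j * m)%N <= delta (s + j * m)%N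
      + (if s == r i then 2 * L * eta (s.+1 + j * m)%N else 0).
  move=> jk; rewrite /delta w_step// w'_step//.
  have eta_t : 0 < eta (s.+1 + j * m)%N <= 2 / beta.
    by apply: eta_bnd; have := ltn_ord s; nia.
  case: eqP => [_|s_ri].
    by case/andP: eta_t => eta0 _; apply: grad_step_lipschitz => //; exact: ltW.
  (* Position [s] other than [r i] holds an index other than [i], so both runs use the same
     example. *)
  rewrite addr0 -S_Si; first exact: grad_step_nonexpansive eta_t.
  by apply/eqP => ri; apply: s_ri; rewrite -ri permKV.
(* After [s] steps of pass [j] the extra term is present exactly when position [r i] has been
   processed, that is when [r i < s], as positions start at 0. *)
have pass j s : (j < k)%N -> (s <= m)%N ->
    delta (s + j * m)%N <= delta (j * m)%N
      + (if (r i < s)%N then 2 * L * eta ((r i).+1 + j * m)%N else 0).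
  move=> jk; elim: s => [|s IH] sm; first by rewrite add0n ltn0 addr0.
  have := step j (Ordinal sm) jk; have := IH (ltnW sm).
  rewrite -val_eqE /= ltnS [in X in _ -> _ -> X]leq_eqVlt (eq_sym s).
  by case: (ltngtP (r i : nat) s) => [||<-] /=; lra.
have passes j : (j <= k)%N ->
    delta (j * m)%N <= 2 * L * \sum_(0 <= l < j) eta ((r i).+1 + l * m)%N.
  elim: j => [|j IH] jk.
    by rewrite mul0n big_nil mulr0 /delta w_0 w'_0 subrr -(scale0r 0) enormZ
      normr0 mul0r.
  (* The end of pass [j], at [m + j * m], is the start of the next one, so [pass] with [s = m] adds
     the [j]-th summand. *)
  rewrite big_nat_recr//= mulrDr mulSn.
  by have := pass j m jk (leqnn m); have := IH (ltnW jk); rewrite ltn_ord; lra.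
exact: passes.
Qed.
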